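(* There is an absolute constant $C>0$ such that the following holds. Let $G$ be a group with a symmetric finite generating set $S$. Suppose that $G$ contains as a subgroup a direct sum $H=\bigoplus_{i\in I}B_i$ of groups $B_i$, where $I$ is a countable set. Let $$v(i,n)=\#\{b\in B_i:\ b\ne e,\ l_S(b)\le n\},\qquad N(n,k)=\#\{i\in I:\ v(i,n)\ge k\}.$$ Then the Følner function of $G$ satisfies $$\mathrm{F\o l}_{G,S}(n)\ \ge\ (k+1)^{C\,N(n,k)}$$ for any $n,k\in\mathbb N$.
   Context: $\#A$ denotes the cardinality of $A$; $d_S$ is the word metric on $G$ with respect to $S$, and $l_S(g)=d_S(e,g)$ is the word length. For $V\subset G$, the boundary $\partial_S V$ is the set of elements $v\in V$ at word distance one from the complement $G\setminus V$. The Følner function $\mathrm{F\o l}_{G,S}(n)$ is the minimum of $\#V$ over finite non-empty sets $V\subset G$ with $\#\partial_S V/\#V\le 1/n$; it is well defined whenever $G$ is a finitely generated amenable group.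
   Formalization: The case n = 1 is excluded: there every one-element V satisfies the boundary condition, so the Følner function equals 1, and the claim fails e.g. for G = B_1 = Z/2, S = {a}, k = 1, where it would read 1 ≥ 2^C. *)

(* Defs.v *)
From HB Require Import structures.
From mathcomp Require Export all_boot all_order all_algebra finmap.
From mathcomp Require Export boolp classical_sets functions.
From mathcomp Require Export cardinality reals constructive_ereal ereal exp.

Set Implicit Arguments.
Unset Strict Implicit.
Unset Printing Implicit Defensive.

Import Order.TTheory GRing.Theory Num.Theory.

Local Open Scope classical_set_scope.
Local Open Scope fset_scope.
Local Open Scope ring_scope.

(* The value is 0 when A is infinite, since fset_set A is then empty. *)
Definition card (T : choiceType) (A : set T) : nat := #|` fset_set A|.

Section WordMetric.
Variables (G : groupType) (S : {fset G}).

Definition symmetric_set : Prop := forall s, s \in S -> (s^-1)%g \in S.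

Definition is_word (w : seq G) : bool :=
  all (fun x => (x \in S) || ((x^-1)%g \in S)) w.

Definition generates : Prop :=
  forall g : G, exists2 w, is_word w & g = (\prod_(x <- w) x)%g.

Definition has_word_of_size (g : G) (n : nat) : Prop :=
  exists w, [/\ is_word w, size w = n & g = (\prod_(x <- w) x)%g].

(* The default 0 is only reached when g is not in the subgroup generated
   by S. *)
Definition word_length (g : G) : nat :=
  xget 0%N [set n | has_word_of_size g n /\
                    forall m, has_word_of_size g m -> (n <= m)%N].

Definition word_dist (g h : G) : nat := word_length (g^-1 * h)%g.

Definition boundary (V : {fset G}) : {fset G} :=
  [fset v in V | `[< exists u, u \notin V /\ word_dist v u = 1%N >]].

(* Extended-real valued, so that it is +oo if no V is admissible (for n > 0
   this can only happen if G is not amenable); otherwise the infimum, being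
   one of natural numbers, is a minimum. *)
Definition folner (R : realType) (n : nat) : \bar R :=
  ereal_inf [set (#|` V|%:R)%:E | V in
    [set V : {fset G} | V != fset0 /\
       #|` boundary V|%:R / #|` V|%:R <= n%:R^-1 :> R]].

End WordMetric.

Section DirectSum.
Variables (I : choiceType) (B : I -> groupType).

Definition finitely_supported (f : forall i, B i) : bool :=
  `[< finite_set [set i | f i != 1%g] >].

Record dsum := DSum {
  dsum_fun :> forall i, B i;
  dsum_finite : finitely_supported dsum_fun }.

HB.instance Definition _ := [isSub for dsum_fun].
HB.instance Definition _ := [Choice of dsum by <:].

Fact dsum_one_subproof : finitely_supported (fun i => 1%g : B i).
Proof.
apply/asboolP; rewrite (_ : [set _ | _] = set0); first exact: finite_set0.
by apply/seteqP; split => i //=; rewrite eqxx.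
Qed.
Definition dsum_one : dsum := DSum dsum_one_subproof.

Fact dsum_mul_subproof (f g : dsum) :
  finitely_supported (fun i => (f i * g i)%g).
Proof.
apply/asboolP.
have /asboolP Ff := dsum_finite f; have /asboolP Fg := dsum_finite g.
apply: (@sub_finite_set _ _ ([set i | f i != 1%g] `|` [set i | g i != 1%g])).
  move=> i /=; case: (eqVneq (f i) 1%g) => [->|]; last by left.
  by rewrite mul1g; right.
by rewrite finite_setU.
Qed.
Definition dsum_mul (f g : dsum) : dsum := DSum (dsum_mul_subproof f g).

Fact dsum_inv_subproof (f : dsum) : finitely_supported (fun i => (f i)^-1%g).
Proof.
have /asboolP Ff := dsum_finite f.
apply/asboolP; apply: sub_finite_set Ff => i /=.
by apply: contra => /eqP ->; rewrite invg1.
Qed.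
Definition dsum_inv (f : dsum) : dsum := DSum (dsum_inv_subproof f).

Fact dsum_ext (f g : dsum) : (forall i, f i = g i) -> f = g.
Proof. by move=> fg; apply/val_inj/functional_extensionality_dep. Qed.

Fact dsum_mulA : associative dsum_mul.
Proof. by move=> f g h; apply: dsum_ext => i /=; rewrite mulgA. Qed.
Fact dsum_mul1g : left_id dsum_one dsum_mul.
Proof. by move=> f; apply: dsum_ext => i /=; rewrite mul1g. Qed.
Fact dsum_mulg1 : right_id dsum_one dsum_mul.
Proof. by move=> f; apply: dsum_ext => i /=; rewrite mulg1. Qed.
Fact dsum_mulVg : left_inverse dsum_one dsum_inv dsum_mul.
Proof. by move=> f; apply: dsum_ext => i /=; rewrite mulVg. Qed.
Fact dsum_mulgV : right_inverse dsum_one dsum_inv dsum_mul.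
Proof. by move=> f; apply: dsum_ext => i /=; rewrite mulgV. Qed.

HB.instance Definition _ :=
  isGroup.Build dsum
    dsum_mulA dsum_mul1g dsum_mulg1 dsum_mulVg dsum_mulgV.

Fact dsum_in_subproof (i : I) (b : B i) :
  finitely_supported (dfwith (fun j => 1%g : B j) b).
Proof.
apply/asboolP; apply: (@sub_finite_set _ _ [set i]); last exact: finite_set1.
by move=> j /=; case: dfwithP => [//|k _]; rewrite eqxx.
Qed.
Definition dsum_in (i : I) (b : B i) : dsum := DSum (dsum_in_subproof b).

End DirectSum.

Section Counting.
Variables (G : groupType) (S : {fset G}).
Variables (I : choiceType) (B : I -> groupType) (iota : dsum B -> G).

Definition factor_ball (i : I) (n : nat) : nat :=
  card [set b : B i | b != 1%g /\ (word_length S (iota (dsum_in b)) <= n)%N].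

(* For k > 0 this set is finite as soon as S is generating and iota is an
   injective morphism. *)
Definition num_factors (n k : nat) : nat :=
  card [set i : I | (k <= factor_ball i n)%N].

End Counting.

(* Main.v *)
Require Import Defs.
From mathcomp Require Import ring lra zify.

(** The constant is C = 1/4.  Let V be a finite non-empty set whose boundary
    dV satisfies #dV / #V <= 1/n.

    Invariance.  Write exits A g for the number of v in A with v g outside A.
    Bounding exits V g by the number of times the path from v to v g can leave
    V only gives exits V g <= l(g) #dV, which is void when l(g) = n.  The
    remedy is to follow the interior U of V as well.  For a letter s, a point
    of U leaving U along s lands on a point of dV from which s^-1 does not
    leave V, whereas exits V s = exits V s^-1 counts the points of dV from
    which s^-1 does leave V; so exits V s + exits U s <= #dV.  Exits are
    subadditive along words, and exits V g <= #dV + exits U g, whence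
    2 exits V g <= (l(g) + 1) #dV (exits_word_length).  If l(g) <= n and
    n <> 1, at least a quarter of V is therefore mapped into V by g.

    Entropy.  Give an equivalence relation E on V the mass
    sum_v ln #(class of v), which is #V times the conditional entropy of a
    uniform point of V given its class.  If E and F refine K and meet in the
    identity, the masses of E and F add up to at most that of K
    (log_mass_split): for w and u in a K-class at most one v is E-related to w
    and F-related to u.  For the cosets of the B_i with i in a finite set J
    this gives by induction on J
      sum_(i in J) sum_(v in V) ln #(V :&: v B_i) <= #V ln #V.

    Conclusion.  Let T be a set of t >= k nontrivial elements of B_i of length
    at most n.  If d of them map v into V, then ln #(V :&: v B_i) >= ln (1 + d),
    and ln (1 + d) >= (d / t) ln (1 + t) by concavity.  By invariance the
    average of d over V is at least t / 4, so each i in J contributes at least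
    (#V / 4) ln (1 + k), and (N / 4) ln (1 + k) <= ln #V. *)

Set Implicit Arguments.
Unset Strict Implicit.
Unset Printing Implicit Defensive.

Import Order.TTheory GRing.Theory Num.Theory.

Local Open Scope ring_scope.

(** * Inequalities for the logarithm *)

Section Logarithm.
Variable R : realType.
Implicit Types x y : R.

Lemma ln_natr_ge0 (n : nat) : 0 <= ln (n%:R : R).
Proof.
case: n => [|n]; first by rewrite ln0.
by apply: ln_ge0; rewrite ler1n.
Qed.

Lemma ln_le_subr1 x : 0 < x -> ln x <= x - 1.
Proof.
move=> x0; have := @le_ln1Dx R (x - 1); rewrite addrCA subrr addr0; apply; lra.
Qed.

(** The graph of ln over [1, t + 1] lies above its chord; both ends of the
    chord are compared with the tangent at d + 1. *)
Lemma ln_chord (d t : nat) : (d <= t)%N ->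
  d%:R * ln t.+1%:R <= t%:R * ln d.+1%:R :> R.
Proof.
move=> dt; have y0 : 0 < d.+1%:R :> R by rewrite ltr0n.
have t0 : 0 < t.+1%:R :> R by rewrite ltr0n.
have P : ln d.+1%:R^-1 <= d.+1%:R^-1 - 1 :> R.
  by apply: ln_le_subr1; rewrite invr_gt0.
have Q : ln (t.+1%:R / d.+1%:R) <= t.+1%:R / d.+1%:R - 1 :> R.
  by apply: ln_le_subr1; rewrite divr_gt0.
rewrite lnV ?posrE // in P; rewrite ln_div ?posrE // in Q.
have dt' : 0 <= t%:R - d%:R :> R by rewrite subr_ge0 ler_nat.
have {}P := ler_wpM2l dt' P; have {}Q := ler_wpM2l (ler0n R d) Q.
have := lerD P Q; set a := ln _; set b := ln _.
suff -> : (t%:R - d%:R) * (d.+1%:R^-1 - 1) +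
    d%:R * (t.+1%:R / d.+1%:R - 1) = 0 :> R.
  by lra.
rewrite -(natr1 t) -(natr1 d); field.
by rewrite natr1 pnatr_eq0.
Qed.

End Logarithm.

(** * Entropy of equivalence relations on a finite set *)

Section Classes.
Variables (R : realType) (T : finType).

Lemma card_class_gt0 (E : rel T) v : reflexive E -> (0 < #|E v|)%N.
Proof. by move=> Er; apply/card_gt0P; exists v; apply: Er. Qed.

(** This is #|T| times the conditional entropy, given its E-class, of a uniform
    point of T. *)
Definition log_mass (E : rel T) : R := \sum_v ln #|E v|%:R.

Lemma log_mass_ge0 (E : rel T) : 0 <= log_mass E.
Proof. by apply: sumr_ge0 => v _; apply: ln_natr_ge0. Qed.

Lemma log_mass_le (E : rel T) : reflexive E ->
  log_mass E <= #|T|%:R * ln #|T|%:R.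
Proof.
move=> Er; rewrite mulr_natl -sumr_const; apply: ler_sum => v _.
have E0 := card_class_gt0 v Er.
rewrite ler_ln ?posrE ?ltr0n ?ler_nat ?max_card //.
exact: leq_trans E0 (max_card _).
Qed.

(** The left side counts triples (v, w, u) with E v w and F v u, each with
    weight one over the size of its K-class.  Such a triple is determined by
    the K-related pair (w, u), and the weighted number of K-related pairs is #|T|. *)
Lemma sum_card_class_ratio (E F K : rel T) :
  equivalence_rel E -> equivalence_rel F -> equivalence_rel K ->
  subrel E K -> subrel F K -> (forall v w, E v w -> F v w -> v = w) ->
  \sum_v (#|E v| * #|F v|)%:R / #|K v|%:R <= #|T|%:R :> R.
Proof.
move=> /equivalence_relP [Er Et] /equivalence_relP [Fr Ft].
move=> /equivalence_relP [Kr Kt] EK FK EF.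
have step v : (#|E v| * #|F v|)%:R / #|K v|%:R =
    \sum_(p : T * T | E v p.1 && F v p.2) #|K p.1|%:R^-1 :> R.
  rewrite -(pair_big_dep (E v) (fun _ => F v) (fun w _ => #|K w|%:R^-1)) /=.
  rewrite natrM -mulrA mulr_natl -sumr_const.
  apply: eq_bigr => w /EK Kvw.
  by rewrite sumr_const mulr_natl (eq_card (Kt _ _ Kvw)).
rewrite (eq_bigr _ (fun v _ => step v)) (exchange_big_dep xpredT) //=.
apply: (@le_trans _ _ (\sum_(p : T * T | K p.1 p.2) #|K p.1|%:R^-1)).
  rewrite [leRHS]big_mkcond; apply: ler_sum => -[w u] _ /=.
  have [v /andP[Evw Fvu]|none] := pickP (fun v => E v w && F v u); last first.
    by rewrite big_pred0 //; case: ifP.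
  rewrite (big_pred1 v) => [|v' /=].
    by rewrite -(Kt _ _ (EK _ _ Evw)) (FK _ _ Fvu).
  apply/andP/eqP => [[Ew Fu]|->] //; apply: EF.
    by rewrite (Et _ _ Ew) -(Et _ _ Evw) Er.
  by rewrite (Ft _ _ Fu) -(Ft _ _ Fvu) Fr.
rewrite -(pair_big_dep xpredT K (fun w _ => #|K w|%:R^-1)) /=.
rewrite -sumr_const; apply: ler_sum => w _.
by rewrite sumr_const -[leLHS]mulr_natl mulfV // pnatr_eq0 -lt0n card_class_gt0.
Qed.

(** Subadditivity of entropy, in the form of Gibbs' inequality: ln x <= x - 1
    for the ratio x = #|E v| #|F v| / #|K v|, whose average is at most 1. *)
Lemma log_mass_split (E F K : rel T) :
  equivalence_rel E -> equivalence_rel F -> equivalence_rel K ->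
  subrel E K -> subrel F K -> (forall v w, E v w -> F v w -> v = w) ->
  log_mass E + log_mass F <= log_mass K.
Proof.
move=> Eq Fq Kq EK FK EF.
have := sum_card_class_ratio Eq Fq Kq EK FK EF.
move: Eq Fq Kq => /equivalence_relP [Er _] /equivalence_relP [Fr _].
move=> /equivalence_relP [Kr _].
rewrite -[leRHS]sumr_const -subr_le0 -sumrB => le0.
rewrite -subr_le0 -big_split -sumrB; apply: le_trans le0.
apply: ler_sum => v _ /=.
have E0 : 0 < #|E v|%:R :> R by rewrite ltr0n card_class_gt0.
have F0 : 0 < #|F v|%:R :> R by rewrite ltr0n card_class_gt0.
have K0 : 0 < #|K v|%:R :> R by rewrite ltr0n card_class_gt0.
rewrite natrM -lnM ?posrE // -ln_div ?posrE ?mulr_gt0 //.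
by apply: ln_le_subr1; rewrite divr_gt0 ?mulr_gt0.
Qed.

End Classes.

(** * Translates of sets with small boundary *)

Lemma leq_count_inj (T : choiceType) (U : eqType) (f : T -> U)
    (P : pred T) (Q : pred U) (A : {fset T}) (t : seq U) :
  injective f -> (forall x, x \in A -> P x -> f x \in t /\ Q (f x)) ->
  (count P A <= count Q t)%N.
Proof.
move=> finj PQ; rewrite -!size_filter -(size_map f).
apply: uniq_leq_size => [|y /mapP[x]].
  by rewrite map_inj_uniq // filter_uniq // fset_uniq.
by rewrite !mem_filter => /andP[Px xA] ->; have [-> ->] := PQ _ xA Px.
Qed.

Section Exits.
Variable G : groupType.
Implicit Types (A V : {fset G}) (g h : G).

Definition exits A g : nat := count (fun v => (v * g)%g \notin A) A.

Lemma count_stay A g :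
  (count (fun v => (v * g)%g \in A) A + exits A g = #|` A|)%N.
Proof. exact: count_predC. Qed.

Lemma exits1 A : exits A 1%g = 0%N.
Proof.
apply/eqP; rewrite -leqn0 leqNgt -has_count; apply/hasPn => v /= vA.
by rewrite mulg1 negbK.
Qed.

(** If v leaves A along g h, then v leaves it along g, or v g lies in A and
    leaves it along h. *)
Lemma exitsM A g h : (exits A (g * h)%g <= exits A g + exits A h)%N.
Proof.
pose P v := ((v * g)%g \in A) && ((v * g * h)%g \notin A).
apply: (@leq_trans (exits A g + count P A)).
  rewrite /exits -count_predUI; apply: leq_trans (leq_addr _ _).
  by apply: sub_count => v /=; rewrite /P mulgA; case: ((v * g)%g \in A).
rewrite leq_add2l; apply: (leq_count_inj (f := fun v => (v * g)%g)).
- exact: mulIg.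
- by move=> v _ /andP[].
Qed.

(** Right translation by g identifies the points that stay in A along g with
    those that stay along g^-1. *)
Lemma exitsV A g : exits A g^-1%g = exits A g.
Proof.
suff stay h : (count (fun v => (v * h)%g \in A) A <=
               count (fun v => (v * h^-1)%g \in A) A)%N.
  apply/eqP; rewrite -(eqn_add2l (count (fun v => (v * g)%g \in A) A)).
  rewrite count_stay -(count_stay A g^-1%g) eqn_add2r eqn_leq stay /=.
  by have := stay g^-1%g; rewrite invgK.
apply: (leq_count_inj (f := fun v => (v * h)%g)); first exact: mulIg.
by move=> v vA vhA; rewrite mulgK.
Qed.

End Exits.

Section WordLength.
Variables (G : groupType) (S : {fset G}).
Implicit Types (V : {fset G}) (g s : G).

Lemma word_length_attained g : generates S ->
  has_word_of_size S g (word_length S g).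
Proof.
move=> gen; rewrite /word_length; case: xgetP => [n _ []//|none].
have ex : exists n, `[< has_word_of_size S g n >].
  by have [w ww gw] := gen g; exists (size w); apply/asboolP; exists w.
case: (ex_minnP ex) => n /asboolP gn nmin.
by case: (none n); split=> // m gm; apply/nmin/asboolP.
Qed.

Lemma word_length_letter s : (s \in S) || ((s^-1)%g \in S) -> s != 1%g ->
  word_length S s = 1%N.
Proof.
move=> sS s1; rewrite /word_length.
have s_word : has_word_of_size S s 1.
  by exists [:: s]; rewrite /is_word /= sS /= big_seq1.
have no_word0 : ~ has_word_of_size S s 0.
  by move=> [w [_ /size0nil -> sE]]; rewrite sE big_nil eqxx in s1.
case: xgetP => [n _ [sn nmin]|none].
  by apply/eqP; rewrite eqn_leq nmin // lt0n; apply/eqP => n0; rewrite n0 in sn.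
by case: (none 1%N); split=> // -[].
Qed.

Lemma exit_boundary V v s : (s \in S) || ((s^-1)%g \in S) ->
  v \in V -> (v * s)%g \notin V -> v \in boundary S V.
Proof.
move=> sS vV vsV; rewrite !inE vV; apply/asboolP; exists (v * s)%g; split=> //.
rewrite /word_dist mulKg word_length_letter //.
by apply: contraNneq vsV => ->; rewrite mulg1.
Qed.

Let interior V := (V `\` boundary S V)%fset.

(** The two terms count disjoint parts of the boundary: the points where s^-1
    leaves V, and the points where it does not, among which are the images
    under s of the interior points that cease to be interior. *)
Lemma exits_letter V s : (s \in S) || ((s^-1)%g \in S) ->
  (exits V s + exits (interior V) s <= #|` boundary S V|)%N.
Proof.
move=> sS; rewrite -exitsV.
have sVS : (s^-1%g \in S) || ((s^-1)^-1%g \in S) by rewrite invgK orbC.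
have bV v : v \in boundary S V -> v \in V by rewrite !inE => /andP[].
rewrite -(count_predC (fun u => (u * s^-1)%g \notin V) (boundary S V)).
apply: leq_add.
  apply: (leq_count_inj (f := id)) => // v vV vsV; split=> //.
  exact: exit_boundary vsV.
apply: (leq_count_inj (f := fun v => (v * s)%g)) => //; first exact: mulIg.
move=> v; rewrite in_fsetD => /andP[vB vV] vsU /=.
have vsV : (v * s)%g \in V by apply: contraNT vB; apply: exit_boundary.
by rewrite mulgK negbK; split=> //; move: vsU; rewrite in_fsetD vsV andbT negbK.
Qed.

Lemma exits_word V w : is_word S w ->
  (exits V (\prod_(x <- w) x)%g + exits (interior V) (\prod_(x <- w) x)%g
     <= size w * #|` boundary S V|)%N.
Proof.
elim: w => [|s w IH] /=; first by rewrite !big_nil !exits1.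
move=> /andP[sS /IH ww]; rewrite !big_cons mulSn.
apply: leq_trans (leq_add (exits_letter V sS) ww).
by rewrite addnACA leq_add // exitsM.
Qed.

(** A point whose translate by g is outside V is a boundary point or an interior
    point that leaves the interior, so exits V g is at most the boundary plus
    the exits from the interior.  Adding exits_word cancels the latter. *)
Lemma exits_word_length V g : generates S ->
  (2 * exits V g <= (word_length S g).+1 * #|` boundary S V|)%N.
Proof.
move=> gen; have [w [ww <- ->]] := word_length_attained g gen.
set g' := (\prod_(x <- w) x)%g; pose dV := boundary S V.
have near : (exits V g' <= #|` dV| + exits (interior V) g')%N.
  pose P v := (v \notin dV) && ((v * g')%g \notin V).
  apply: (@leq_trans (count (mem dV) V + count P V)).
    rewrite -count_predUI; apply: leq_trans (leq_addr _ _).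
    by apply: sub_count => v /=; rewrite /P; case: (v \in dV).
  apply: leq_add.
    rewrite -(count_predT dV); apply: (leq_count_inj (f := id)) => //.
    apply: (leq_count_inj (f := id)) => [//|v vV /andP[vd vgV]].
    by rewrite !in_fsetD vd vV (negPf vgV) andbF.
by have := exits_word V ww; rewrite -/g' -/dV; lia.
Qed.

End WordLength.

(** * Cosets of partial sums of a direct sum *)

Section DirectSumCosets.
Variables (G : groupType) (I : choiceType) (B : I -> groupType).
Variables (iota : {multiplicative dsum B -> G}) (iota_inj : injective iota).
Implicit Types (J : seq I) (i : I).

Lemma morph1 : iota 1%g = 1%g.
Proof. by apply: (@mulgI G (iota 1%g)); rewrite -gmulfM !mulg1. Qed.

Lemma morphV h : iota h^-1%g = (iota h)^-1%g.
Proof. by apply: (@mulgI G (iota h)); rewrite -gmulfM !mulgV morph1. Qed.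

(** Lying in the same left coset of the image of the partial sum over J. *)
Definition coset_rel J : rel G := fun v w =>
  `[< exists2 h : dsum B, forall i, i \notin J -> h i = 1%g &
                          (v^-1 * w)%g = iota h >].

Lemma coset_rel_equiv J : equivalence_rel (coset_rel J).
Proof.
have Er : reflexive (coset_rel J).
  by move=> v; apply/asboolP; exists 1%g; rewrite ?mulVg ?morph1.
have Et : transitive (coset_rel J).
  move=> w v u /asboolP[h hJ vw] /asboolP[h' h'J wu]; apply/asboolP.
  exists (h * h')%g; last by rewrite gmulfM -vw -wu mulgA mulgK.
  by move=> i iJ; rewrite /= hJ // h'J // mulg1.
have Es v w : coset_rel J v w -> coset_rel J w v.
  move=> /asboolP[h hJ vw]; apply/asboolP.
  exists h^-1%g; last by rewrite morphV -vw invgM invgK.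
  by move=> i iJ; rewrite /= hJ // invg1.
apply/equivalence_relP; split=> // v w vw u.
by apply/idP/idP; apply: Et => //; apply: Es.
Qed.

Lemma coset_rel_sub J J' : {subset J <= J'} ->
  subrel (coset_rel J) (coset_rel J').
Proof.
move=> JJ' v w /asboolP[h hJ vw]; apply/asboolP; exists h => // i iJ'.
by apply: hJ; apply: contra iJ'; apply: JJ'.
Qed.

(** The factor of index i meets the sum of the factors over J trivially. *)
Lemma coset_rel_disjoint i J v w : i \notin J ->
  coset_rel [:: i] v w -> coset_rel J v w -> v = w.
Proof.
move=> iJ /asboolP[h hi vw] /asboolP[h' h'J vw'].
have hh' : h = h' by apply: iota_inj; rewrite -vw.
suff h1 : h = 1%g.
  by move: vw; rewrite h1 morph1 => /(canRL (mulVKg _)); rewrite mulg1.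
apply: dsum_ext => j; have [->|ji] := eqVneq j i; first by rewrite hh' h'J.
by rewrite hi // inE.
Qed.

Variables (R : realType) (V : {fset G}).

Definition coset_mass J : R := log_mass R (relpre (val : V -> G) (coset_rel J)).

Lemma relpre_equiv J : equivalence_rel (relpre (val : V -> G) (coset_rel J)).
Proof. by move=> u v w; apply: coset_rel_equiv. Qed.

(** The cosets for [:: i] and for J refine those for i :: J and meet in points,
    so log_mass_split peels off one factor at a time. *)
Lemma sum_coset_mass_le J : uniq J ->
  \sum_(i <- J) coset_mass [:: i] <= coset_mass J.
Proof.
elim: J => [|i J IH] /=; first by rewrite big_nil log_mass_ge0.
move=> /andP[iJ /IH mJ]; rewrite big_cons.
apply: le_trans (lerD (lexx _) mJ) _; apply: log_mass_split.
- exact: relpre_equiv.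
- exact: relpre_equiv.
- exact: relpre_equiv.
- move=> v w; apply: coset_rel_sub => j.
  by rewrite !inE => /eqP ->; rewrite eqxx.
- by move=> v w; apply: coset_rel_sub => j; rewrite inE orbC => ->.
- by move=> v w vw vw'; apply: val_inj; apply: coset_rel_disjoint vw vw'.
Qed.

Lemma dsum_in_inj i : injective (@dsum_in I B i).
Proof.
by move=> b c /(congr1 (fun h : dsum B => h i)); rewrite /= !dfwith_in.
Qed.

Lemma dsum_in1 i : dsum_in (1%g : B i) = 1%g.
Proof. by apply: dsum_ext => j /=; case: dfwithP. Qed.

Definition embed i (b : B i) : G := iota (dsum_in b).

(** The inequality is strict because v itself, the image of 1, is in the class
    and is not v b for any b in T. *)
Lemma card_coset_ge i (T : {fset B i}) (v : V) : 1%g \notin T ->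
  (count (fun b => val v * embed b \in V)%g T
     < #|relpre (val : V -> G) (coset_rel [:: i]) v|)%N.
Proof.
move=> T1.
set s := [seq b <- 1%g :: (T : seq (B i)) | (val v * embed b)%g \in V].
(* The default v is never used: f is only applied to b with v b in V. *)
pose f (b : B i) : V := insubd v (val v * embed b)%g.
have e1 : (val v * embed (1%g : B i))%g = val v.
  by rewrite /embed dsum_in1 morph1 mulg1.
have fE b : b \in s -> val (f b) = (val v * embed b)%g.
  by rewrite mem_filter => /andP[vb _]; rewrite val_insubd vb.
have <- : size (map f s) = (count (fun b => val v * embed b \in V)%g T).+1.
  by rewrite size_map size_filter /= e1 fsvalP.
rewrite cardE; apply: uniq_leq_size => [|u /mapP[b bs ->]].
  rewrite map_inj_in_uniq ?filter_uniq //= ?T1 ?fset_uniq // => b c bs cs.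
  move=> /(congr1 val); rewrite !fE // => /mulgI /iota_inj; exact: dsum_in_inj.
rewrite mem_enum unfold_in /= fE //; apply/asboolP; exists (dsum_in b).
  by move=> j; rewrite inE /= => ji; rewrite dfwith_out // eq_sym.
by rewrite mulKg.
Qed.

(** By double counting, the number of b in T that keep v in V is on average at
    least #T / 4; the chord inequality makes the logarithm linear in it. *)
Lemma coset_mass_ge i (T : {fset B i}) : 1%g \notin T ->
  (forall b, b \in T -> 4 * exits V (embed b) <= 3 * #|` V|)%N ->
  #|` V|%:R / 4 * ln #|` T|.+1%:R <= coset_mass [:: i].
Proof.
move=> T1 few.
have [/eqP t0|t0] := posnP #|` T|.
  by rewrite (eqP t0) ln1 mulr0; apply: log_mass_ge0.
pose d (v : G) := count (fun b => (v * embed b)%g \in V) T.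
have t0R : 0 < #|` T|%:R :> R by rewrite ltr0n.
have dmass : (\sum_(v <- V) (d v)%:R) * ln #|` T|.+1%:R
    <= #|` T|%:R * coset_mass [:: i].
  rewrite big_seq_fsetE /= mulr_suml mulr_sumr; apply: ler_sum => v _.
  apply: le_trans (ln_chord R (count_size _ _)) _.
  rewrite ler_pM2l // ler_ln ?posrE ?ltr0n ?ler_nat ?card_coset_ge //.
  exact: leq_ltn_trans (card_coset_ge _ T1).
have stays : (#|` T| * #|` V| <= 4 * \sum_(v <- V) d v)%N.
  have dE v : d v = (\sum_(b <- T) ((v * embed b)%g \in V))%N.
    by rewrite /d -sum1_count [LHS]big_mkcond.
  rewrite (eq_bigr _ (fun v _ => dE v)) exchange_big big_distrr /=.
  rewrite -sum1_size big_distrl /=.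
  rewrite !big_seq; apply: leq_sum => b bT; rewrite mul1n.
  have -> : (\sum_(v <- V) ((v * embed b)%g \in V) =
             count (fun v => (v * embed b)%g \in V) V)%N.
    by rewrite -sum1_count [RHS]big_mkcond.
  have := few b bT; have := count_stay V (embed b).
  by move: (exits _ _) (count _ _) #|` V| => e c m; lia.
rewrite -(ler_pM2l t0R); apply: le_trans dmass.
rewrite mulrA ler_wpM2r ?ln_natr_ge0 // mulrA ler_pdivrMr // -natrM -natr_sum.
by rewrite -natrM ler_nat mulnC; lia.
Qed.

End DirectSumCosets.

(** * The lower bound on the Følner function *)

Lemma in_fset_set_sub (T : choiceType) (A : set T) x : x \in fset_set A -> A x.
Proof.
rewrite /fset_set; case: pselect => // fA.
by case: cid => X /= AX xX; rewrite AX.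
Qed.

Theorem corollary1p2 (R : realType) :
  exists C : R, 0 < C /\
  forall (G : groupType) (S : {fset G})
    (hsym : symmetric_set S) (hgen : generates S)
    (I : countType) (B : I -> groupType)
    (iota : {multiplicative dsum B -> G}) (hinj : injective iota)
    (n k : nat) (hn : n <> 1%N),
  (((k.+1)%:R `^ (C * (num_factors S iota n k)%:R))%:E <= folner S R n)%E.
Proof.
exists 4^-1; split; first by rewrite invr_gt0.
move=> G S _ hgen I B iota hinj n k hn.
apply/ereal_infP => _ [V [V0 bdV] <-]; rewrite lee_fin.
have cV : (0 < #|` V|)%N by rewrite cardfs_gt0.
have cVR : 0 < #|` V|%:R :> R by rewrite ltr0n.
have few g : (word_length S g <= n)%N -> (4 * exits V g <= 3 * #|` V|)%N.
  move=> gn; have e := exits_word_length V g hgen.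
  have bd : (n * #|` boundary S V| <= #|` V|)%N /\
            (n = 0 -> #|` boundary S V| = 0)%N.
    move: bdV; rewrite ler_pdivrMr //; case: (n) => [|m].
      by rewrite invr0 mul0r lern0 => /eqP ->; rewrite muln0.
    by rewrite mulrC ler_pdivlMr ?ltr0n // -natrM ler_nat mulnC.
  case: bd; move: hn gn e.
  move: (exits _ _) (word_length _ _) #|` boundary S V| #|` V| => a m b c.
  (* If n > 1, then (n + 1) / (2 n) <= 3/4; if n = 0, the boundary is empty. *)
  case: (n) => [|[|p]] // _ mn e bc b0.
    by move: e; rewrite b0 // muln0; lia.
  by nia.
set J := fset_set [set i : I | (k <= factor_ball S iota i n)%N].
have mass_i i : i \in J ->
    #|` V|%:R / 4 * ln k.+1%:R <= coset_mass iota R V [:: i].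
  move=> /in_fset_set_sub /= ki.
  pose T := fset_set [set b : B i | b != 1%g /\
                        (word_length S (iota (dsum_in b)) <= n)%N].
  have TP (b : B i) : b \in T -> b != 1%g /\
      (word_length S (iota (dsum_in b)) <= n)%N.
    exact: in_fset_set_sub.
  apply: le_trans (coset_mass_ge hinj R (T := T) _ _).
  - rewrite ler_wpM2l ?divr_ge0 // ler_ln ?posrE ?ltr0n // ler_nat ltnS.
    exact: ki.
  - by apply/negP => /TP[]; rewrite eqxx.
  - by move=> b /TP[_ bn]; apply: few.
have massJ : #|` J|%:R * (#|` V|%:R / 4 * ln k.+1%:R) <=
    #|` V|%:R * ln #|` V|%:R :> R.
  apply: (@le_trans _ _ (\sum_(i <- J) coset_mass iota R V [:: i])).
    rewrite mulr_natl [#|` J|]cardfE -sumr_const big_seq_fsetE.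
    by apply: ler_sum => i _; apply: mass_i (fsvalP i).
  apply: le_trans (sum_coset_mass_le hinj _ _ (fset_uniq J)) _.
  rewrite cardfE; apply: log_mass_le.
  by have /equivalence_relP[] := relpre_equiv iota (V := V) J.
have k0 : 0 < k.+1%:R :> R by rewrite ltr0n.
rewrite -ler_ln ?posrE ?powR_gt0 // ln_powR -(ler_pM2l cVR).
by apply: le_trans massJ; rewrite /num_factors /card -/J; lra.
Qed.
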